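(* Consider one-dimensional OFDM signals of length $N$ with $L$ deterministic unit-amplitude pilots and i.i.d. random data symbols on the remaining indices, as set out in the context. Let $\mathbf{p}$ and $\mathbf{w}$ be the pilot vector and the pilot mask, and let $c\in\mathbb{Z}$. If the pilot pattern is cyclically shifted by $c$ positions, i.e. $\mathbf{p}$ and $\mathbf{w}$ are replaced by $\mathbf{p}'$ and $\mathbf{w}'$ with $p'_n=p_{\langle n-c\rangle_N}$ and $w'_n=w_{\langle n-c\rangle_N}$ for all $n\in\mathbb{Z}_N$ (the data symbols then occupying the indices where $w'_n=0$), then the expected squared DP-AF $\mathbb{E}\left(|\mathcal{X}^{\mathrm{DP}}(k,q)|^2\right)$ is unchanged for every $(k,q)\in\mathbb{Z}_N^2$.
   Context: Let $j$ be the imaginary unit, $N\ge 1$, $0\le L\le N$, $\mathbb{Z}_N=\{0,1,\dots,N-1\}$, and $\langle\cdot\rangle_N$ denote reduction modulo $N$. Indices start from $0$. $\mathbf{F}_N$ is the normalized DFT matrix with entries $(\mathbf{F}_N)_{m,n}=\frac{1}{\sqrt N}e^{-j2\pi mn/N}$. Signal model. $I\subseteq\mathbb{Z}_N$ is a set with $L$ elements (pilot pattern). The symbol vector $\mathbf{s}\in\mathbb{C}^N$ has deterministic pilot entries $s_i$ with $|s_i|=1$ for $i\in I$ (unit-amplitude pilots), while the entries $s_i$, $i\notin I$, are i.i.d. random data symbols, each distributed as a complex random variable $d$ (the same distribution before and after shifting) with finite fourth moment and $$\mathbb{E}(d)=0,\quad \mathbb{E}(|d|^2)=1,\quad \mathbb{E}(d^2)=0,\quad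 \mathbb{E}(d|d|^2)=\mathbb{E}(d^*|d|^2)=0.$$ The pilot vector $\mathbf{p}$ has $p_i=s_i$ for $i\in I$ and $p_i=0$ otherwise; the binary pilot mask $\mathbf{w}$ has $w_i=1$ for $i\in I$ and $w_i=0$ otherwise. Ambiguity function. $\mathbf{R}_{N,k}$ is the cyclic shift, $(\mathbf{R}_{N,k}\mathbf{x})_n=x_{\langle n-k\rangle_N}$, and $\mathbf{\Phi}_{N,q}=\mathrm{Diag}(1,e^{j2\pi q/N},\dots,e^{j2\pi q(N-1)/N})$. The discrete periodic ambiguity function (DP-AF) is $\mathcal{X}^{\mathrm{DP}}(k,q)=\mathbf{x}^H\mathbf{R}_{N,k}^T\mathbf{\Phi}_{N,q}^*\mathbf{x}$ with $\mathbf{x}=\mathbf{F}_N^H\mathbf{s}$, for $(k,q)\in\mathbb{Z}_N^2$. *)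

(* Defs.v *)
From HB Require Import structures.
From mathcomp Require Import all_boot all_order all_algebra.
From mathcomp Require Import complex.
From mathcomp Require Import all_classical all_reals all_analysis.

Set Implicit Arguments.
Unset Strict Implicit.
Unset Printing Implicit Defensive.

Import Order.TTheory GRing.Theory Num.Theory.
Import numFieldNormedType.Exports.

Local Open Scope classical_set_scope.
Local Open Scope ring_scope.
Local Open Scope complex_scope.
Local Open Scope sesquilinear_scope.

Lemma mod_sub_subproof (N : nat) (k : int) (n : 'I_N) :
  (absz ((n%:Z - k) %% N%:Z)%Z < N)%N.
Proof.
have N0 : N%:Z != 0 by case: N n => [[]|].
have h1 := modz_ge0 (n%:Z - k) N0.
by rewrite -ltz_nat gez0_abs// ltz_pmod// lt_neqAle eq_sym N0 lez_nat.
Qed.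

(* <n - k>_N; the index n : 'I_N already forces 0 < N. *)
Definition mod_sub (N : nat) (k : int) (n : 'I_N) : 'I_N :=
  Ordinal (mod_sub_subproof k n).

Definition cyclic_shift (A : Type) (N : nat) (k : int) (x : 'cV[A]_N) : 'cV[A]_N :=
  \col_n x (mod_sub k n) 0.

Section Ambiguity.
Variable R : realType.

(* e^{j x} for real x *)
Definition expj (x : R) : R[i] := cos x +i* sin x.

Definition dft_mx (N : nat) : 'M[R[i]]_N :=
  \matrix_(m, n) (((Num.sqrt N%:R)^-1)%:C
                  * expj (- (2 * pi * m%:R * n%:R / N%:R))).

Definition shift_mx (N : nat) (k : int) : 'M[R[i]]_N :=
  \matrix_(n, m) (m == mod_sub k n)%:R.

Lemma shift_mxE (N : nat) (k : int) (x : 'cV[R[i]]_N) :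
  shift_mx N k *m x = cyclic_shift k x.
Proof.
apply/colP => n; rewrite !mxE (bigD1 (mod_sub k n))//= mxE eqxx mul1r.
by rewrite big1 ?addr0// => m /negPf mn; rewrite mxE mn mul0r.
Qed.

Definition phase_mx (N : nat) (q : nat) : 'M[R[i]]_N :=
  diag_mx (\row_n expj (2 * pi * q%:R * n%:R / N%:R)).

Definition ofdm_signal (N : nat) (s : 'cV[R[i]]_N) : 'cV[R[i]]_N :=
  (dft_mx N)^t* *m s.

Definition dpaf (N : nat) (x : 'cV[R[i]]_N) (k q : 'I_N) : R[i] :=
  (x^t* *m (shift_mx N (k : nat)%:Z)^T *m map_mx Num.conj (phase_mx N q) *m x) 0 0.

End Ambiguity.

Section ComplexRandomVariables.
Context {R : realType}.

(* R[i] carries no sigma-algebra in the library, so complex random variables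
   are handled through R[i] ~ R * R with the product Borel sigma-algebra. *)
Definition toRR (z : R[i]) : R * R := (complex.Re z, complex.Im z).

Definition cmodulus (z : R[i]) : R := ComplexField.Normc.normc z.

Definition complex_rv (d : measure_display) (T : measurableType d)
    (X : T -> R[i]) : Prop :=
  measurable_fun setT (toRR \o X).

Definition same_law (d d' : measure_display) (T : measurableType d)
    (T' : measurableType d') (P : probability T R) (P' : probability T' R)
    (X : T -> R[i]) (Y : T' -> R[i]) : Prop :=
  forall B : set (R * R), measurable B ->
    P ((toRR \o X) @^-1` B) = P' ((toRR \o Y) @^-1` B).

Definition mutually_independent (d : measure_display) (T : measurableType d)
    (P : probability T R) (I : finType) (A : {set I}) (X : I -> T -> R[i])
    : Prop :=
  forall (J : {set I}) (B : I -> set (R * R)),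
    J \subset A -> (forall i, measurable (B i)) ->
    (P (\bigcap_(i in [set i | i \in J]) ((toRR \o X i) @^-1` B i))
     = \prod_(i in J) P ((toRR \o X i) @^-1` B i))%E.

(* Meaningful for integrable X (otherwise [fine] may return a default value);
   below it is only applied under a finite fourth moment. *)
Definition cexpectation (d : measure_display) (T : measurableType d)
    (P : probability T R) (X : T -> R[i]) : R[i] :=
  fine ('E_P[fun t => complex.Re (X t)])
  +i* fine ('E_P[fun t => complex.Im (X t)]).

Record data_symbol_law (d : measure_display) (T : measurableType d)
    (P : probability T R) (X : T -> R[i]) : Prop := DataSymbolLaw {
  symbol_rv : complex_rv X;
  symbol_moment4 : ('E_P[fun t => (cmodulus (X t) ^+ 4)%R] < +oo)%E;
  symbol_mean : cexpectation P X = 0;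
  symbol_power : ('E_P[fun t => (cmodulus (X t) ^+ 2)%R] = 1)%E;
  symbol_square : cexpectation P (fun t => X t ^+ 2) = 0;
  symbol_cubic : cexpectation P (fun t => X t * `|X t| ^+ 2) = 0;
  symbol_conj_cubic :
    cexpectation P (fun t => Num.conj (X t) * `|X t| ^+ 2) = 0
}.

End ComplexRandomVariables.

Section SignalModel.
Context {R : realType}.

Definition unit_pilot_vector (N : nat) (I : {set 'I_N}) (p : 'cV[R[i]]_N)
    : Prop :=
  (forall i, i \in I -> `|p i 0| = 1) /\ (forall i, i \notin I -> p i 0 = 0).

Definition pilot_mask (N : nat) (I : {set 'I_N}) : 'cV[R[i]]_N :=
  \col_i (i \in I)%:R.

(* s is a random symbol vector with pilots p on the mask w and, off the mask,
   i.i.d. data symbols distributed as the complex random variable D. *)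
Record ofdm_symbols (N : nat) (dD : measure_display) (TD : measurableType dD)
    (PD : probability TD R) (D : TD -> R[i]) (p w : 'cV[R[i]]_N)
    (d : measure_display) (T : measurableType d) (P : probability T R)
    (s : T -> 'cV[R[i]]_N) : Prop := OfdmSymbols {
  ofdm_pilot : forall i, w i 0 = 1 -> forall t, s t i 0 = p i 0;
  ofdm_data_rv : forall i, w i 0 = 0 -> complex_rv (fun t => s t i 0);
  ofdm_data_law : forall i, w i 0 = 0 -> same_law P PD (fun t => s t i 0) D;
  ofdm_data_indep :
    mutually_independent P [set i | w i 0 == 0]%SET (fun i t => s t i 0)
}.

Definition expected_sq_dpaf (N : nat) (d : measure_display)
    (T : measurableType d) (P : probability T R) (s : T -> 'cV[R[i]]_N)
    (k q : 'I_N) : \bar R :=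
  ('E_P[fun t => (cmodulus (dpaf (ofdm_signal (s t)) k q) ^+ 2)%R])%E.

End SignalModel.

(* Main.v *)
(* Shifting the symbols by c multiplies the time signal pointwise by
   e^{2 pi j c n / N}, hence multiplies the ambiguity function at (k, q) by the
   unimodular constant e^{2 pi j c k / N}.  The shifted symbol vector has the
   shifted pilots and mask, and the joint law of a symbol vector is determined
   by its pilots, its mask and the law of D; so both expectations agree. *)

Require Import Defs.
From HB Require Import structures.
From mathcomp Require Import all_boot all_order all_algebra.
From mathcomp Require Import complex measurable_realfun.
From mathcomp Require Import all_classical all_reals all_analysis.
Import Order.TTheory GRing.Theory Num.Theory.
Import numFieldNormedType.Exports.
Local Open Scope ring_scope.
Local Open Scope complex_scope.

Set Implicit Arguments.
Unset Strict Implicit.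
Unset Printing Implicit Defensive.

(** * Cyclic shifts of the indices as permutations of ['I_N] *)

Lemma val_mod_sub (N : nat) (k : int) (n : 'I_N) :
  (mod_sub k n : nat)%:Z = ((n%:Z - k) %% N%:Z)%Z.
Proof. by rewrite gez0_abs// modz_ge0//; case: N n => [[]|]. Qed.

Lemma mod_subK (N : nat) (k : int) :
  cancel (@mod_sub N k) (@mod_sub N (- k)).
Proof.
move=> n; apply: val_inj; apply: (can_inj absz_nat).
rewrite !val_mod_sub opprK modzDml subrK modz_small//.
by rewrite le0z_nat ltz_nat ltn_ord.
Qed.

Lemma mod_subNK (N : nat) (k : int) :
  cancel (@mod_sub N (- k)) (@mod_sub N k).
Proof. by rewrite -{2}(opprK k); exact: mod_subK. Qed.

(** * Roots of unity, and the effect of a shift of the symbols on the ambiguity function *)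

Section Roots.
Variable R : realType.

Lemma expjD (x y : R) : expj (x + y) = expj x * expj y.
Proof. by rewrite /expj cosD sinD; simpc; congr (_ +i* _); rewrite addrC. Qed.

Lemma expj0 : expj (0 : R) = 1.
Proof. by rewrite /expj cos0 sin0. Qed.

Lemma conj_expj (x : R) : Num.conj (expj x) = expj (- x).
Proof. by rewrite /expj cosN sinN. Qed.

Lemma expjN (x : R) : expj (- x) = (expj x)^-1.
Proof.
have h : expj x * expj (- x) = 1 by rewrite -expjD subrr expj0.
have x0 : expj x != 0.
  by apply: contra_eq_neq h => ->; rewrite mul0r eq_sym oner_eq0.
by rewrite -[RHS]mulr1 -h mulKf.
Qed.

Lemma normc_expj (x : R) : cmodulus (expj x) = 1.
Proof. by rewrite /cmodulus /= cos2Dsin2 sqrtr1. Qed.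

Lemma expj_period (m : int) : expj (2 * pi * m%:~R : R) = 1.
Proof.
have h1 : expj (2 * pi : R) = 1.
  by rewrite /expj mulr_natl cos2pi sin2pi.
have hn (n : nat) : expj (2 * pi * n%:R : R) = 1.
  elim: n => [|n IH]; first by rewrite mulr0 expj0.
  by rewrite -[n.+1%:R]natr1 mulrDr mulr1 expjD IH h1 mulr1.
case: m => n; first exact: hn.
by rewrite NegzE mulrNz mulrN expjN hn invr1.
Qed.

(** The exponent is an integer so that conjugation becomes negation and differences of indices need
    no truncation. *)
Definition zroot (N : nat) (a : int) : R[i] := expj (2 * pi * a%:~R / N%:R).

Lemma zrootD (N : nat) (a b : int) : zroot N (a + b) = zroot N a * zroot N b.
Proof. by rewrite /zroot intrD mulrDr mulrDl expjD. Qed.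

Lemma conj_zroot (N : nat) (a : int) : Num.conj (zroot N a) = zroot N (- a).
Proof. by rewrite /zroot conj_expj mulrNz mulrN mulNr. Qed.

Lemma zrootMN (N : nat) (a : int) : (0 < N)%N -> zroot N (a * N%:Z) = 1.
Proof.
move=> N0; rewrite /zroot intrM. rewrite (mulrA (2 * pi)) mulfK ?expj_period//.
by rewrite pnatr_eq0 -lt0n.
Qed.

(** Reduction modulo [N] alters the exponent by a multiple of [N], on which [zroot N] is 1. This
    removes every wrap-around from the later phase computations. *)
Lemma zroot_mod_sub (N : nat) (k a : int) (n : 'I_N) :
  zroot N (a * (mod_sub k n : nat)%:Z) = zroot N (a * (n%:Z - k)).
Proof.
have N0 : (0 < N)%N by case: N n => [[]|].
rewrite val_mod_sub [in RHS](divz_eq (n%:Z - k) N) [in RHS]mulrDr mulrA.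
by rewrite zrootD zrootMN// mul1r.
Qed.

Lemma ofdm_signalE (N : nat) (s : 'cV[R[i]]_N) (n : 'I_N) :
  ofdm_signal s n 0 =
  \sum_(m < N) ((Num.sqrt N%:R)^-1)%:C * zroot N (n%:Z * m%:Z) * s m 0.
Proof.
rewrite mxE; apply: eq_bigr => m _; rewrite !mxE rmorphM /=.
congr (_ * _ * _); first exact: conjc_real.
rewrite conj_expj opprK /zroot intrM; congr expj.
by rewrite mulrA (mulrAC _ m%:R).
Qed.

Lemma ofdm_signal_shift (N : nat) (c : int) (s : 'cV[R[i]]_N) (n : 'I_N) :
  ofdm_signal (cyclic_shift c s) n 0 = zroot N (c * n%:Z) * ofdm_signal s n 0.
Proof.
(* The substitution of [m + c] for [m] undoes the shift on [s] and moves it into the exponent, where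
   [n * (m + c)] splits off the factor of exponent [c * n]. *)
rewrite !ofdm_signalE (reindex_inj (can_inj (@mod_subNK N c))) mulr_sumr.
apply: eq_bigr => m _; rewrite mxE mod_subNK zroot_mod_sub opprK mulrDr zrootD.
rewrite (mulrC c) -!mulrA [RHS]mulrCA; congr (_ * _).
exact: mulrCA.
Qed.

Lemma dpafE (N : nat) (x : 'cV[R[i]]_N) (k q : 'I_N) :
  dpaf x k q = \sum_(n < N) Num.conj (x (mod_sub k%:Z n) 0) *
                      Num.conj (zroot N (q%:Z * n%:Z)) * x n 0.
Proof.
rewrite /dpaf mxE; apply: eq_bigr => n _; congr (_ * _).
rewrite map_diag_mx mul_mx_diag !mxE; congr (_ * Num.conj _).
  rewrite (bigD1 (mod_sub k%:Z n))//= !mxE eqxx mulr1 big1 ?addr0// => m mn.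
  by rewrite !mxE (negPf mn) mulr0.
by rewrite /zroot intrM mulrA.
Qed.

(** In each summand the conjugated sample at [n - k] contributes the exponent [- c * (n - k)] and
    the sample at [n] contributes [c * n]. Their sum [c * k] is free of [n] and leaves the sum. *)
Lemma dpaf_modulation (N : nat) (c : int) (x y : 'cV[R[i]]_N) (k q : 'I_N) :
  (forall n, y n 0 = zroot N (c * n%:Z) * x n 0) ->
  dpaf y k q = zroot N (c * k%:Z) * dpaf x k q.
Proof.
move=> yE; rewrite !dpafE mulr_sumr; apply: eq_bigr => n _.
rewrite !yE zroot_mod_sub rmorphM /= conj_zroot.
rewrite -mulrN opprB mulrBr zrootD -!mulrA; congr (_ * _).
rewrite mulrCA; congr (_ * _); rewrite mulrCA; congr (_ * _).
by rewrite mulrA -zrootD addNr /zroot mulr0 mul0r expj0 mul1r.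
Qed.

Lemma cmodulus_dpaf_shift (N : nat) (c : int) (s : 'cV[R[i]]_N) (k q : 'I_N) :
  cmodulus (dpaf (ofdm_signal (cyclic_shift c s)) k q) =
  cmodulus (dpaf (ofdm_signal s) k q).
Proof.
rewrite (dpaf_modulation (c := c) (x := ofdm_signal s)); last first.
  exact: ofdm_signal_shift.
by rewrite /cmodulus ComplexField.Normc.normcM [X in X * _]normc_expj mul1r.
Qed.

End Roots.

(** * Finite measures on a finite power of a measurable space are determined by boxes *)

Section TupleLaw.
Local Open Scope classical_set_scope.
Context {d0 : measure_display} {X : measurableType d0} {R : realType} {n : nat}.

Definition box (B : 'I_n -> set X) : set (n.-tuple X) :=
  [set v | forall i, B i (tnth v i)].

Lemma boxE (B : 'I_n -> set X) :
  box B = \bigcap_(i in [set: 'I_n]) (@tnth n X ^~ i) @^-1` B i.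
Proof. by apply/seteqP; split=> [v Bv i _|v Bv i]; [exact: Bv|exact: (Bv i I)]. Qed.

Lemma measurable_box (B : 'I_n -> set X) :
  (forall i, measurable (B i)) -> measurable (box B).
Proof.
move=> mB; rewrite boxE.
apply: fin_bigcap_measurable => // i _.
by rewrite -[_ @^-1` _]setTI; exact: measurable_tnth.
Qed.

(** Boxes are stable under intersection and generate the product sigma-algebra, so uniqueness of
    measures on a pi-system applies; the constant sequence [setT] serves as the exhausting sequence
    of finite measure. *)
Lemma eq_measure_box (m1 m2 : {measure set (n.-tuple X) -> \bar R}) :
  (m1 setT < +oo)%E ->
  (forall B : 'I_n -> set X, (forall i, measurable (B i)) ->
     m1 (box B) = m2 (box B)) ->
  forall A, measurable A -> m1 A = m2 A.
Proof.
move=> m1oo m12 A mA.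
pose G : set (set (n.-tuple X)) :=
  [set C | exists2 B, (forall i, measurable (B i)) & C = box B].
have boxT : box (fun=> setT) = setT by apply/seteqP; split.
have GT : G setT by exists (fun=> setT).
apply: (@g_sigma_algebra_measure_unique _ R _ G _ (fun=> setT)) => //.
- by move=> _ [B mB ->]; exact: measurable_box.
- by rewrite bigcup_const//; exists 0%N.
- move=> _ _ [B mB ->] [C mC ->]; exists (fun i => B i `&` C i).
    by move=> i; exact: measurableI.
  apply/seteqP; split=> [v [Bv Cv] i|v BCv]; first by split.
  by split=> i; have [] := BCv i.
- by move=> _ [B mB ->]; exact: m12.
- move: A mA; apply: smallest_sub; first exact: smallest_sigma_algebra.
  rewrite -bigcup_seq => C [i _ [B mB <-]]; apply: sub_sigma_algebra.
  (* The tuple sigma-algebra is generated by preimages under single coordinates; such a preimage is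
     a box whose sides are all full except the one at [i]. *)
  exists (fun j => if j == i then B else setT) => [j|].
    by case: ifP.
  rewrite setTI; apply/seteqP; split=> [v Bv j|v /(_ i)]; last by rewrite eqxx.
  by case: eqP => [->|].
Qed.

End TupleLaw.

(** * Measurability of complex random variables, up to the squared ambiguity function *)

Section Cmeasurable.
Local Open Scope classical_set_scope.
Context {R : realType} {d : measure_display} {T : measurableType d}.

Lemma complex_rvP (f : T -> R[i]) :
  complex_rv f <-> measurable_fun setT (fun t => complex.Re (f t)) /\
                   measurable_fun setT (fun t => complex.Im (f t)).
Proof.
split=> [mf|[mr mi]]; last exact: measurable_fun_pair.
by split; [exact: (measurableT_comp measurable_fst mf)|
           exact: (measurableT_comp measurable_snd mf)].
Qed.

Lemma complex_rv_cst (a : R[i]) : complex_rv (fun _ : T => a).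
Proof. exact: measurable_cst. Qed.

Lemma complex_rvD (f g : T -> R[i]) :
  complex_rv f -> complex_rv g -> complex_rv (fun t => f t + g t).
Proof.
move=> /complex_rvP[fr fi] /complex_rvP[gr gi]; apply/complex_rvP.
split.
  rewrite (_ : (fun _ => _) = (fun t => complex.Re (f t) + complex.Re (g t))).
    exact: measurable_funD.
  by apply/funext => t; case: (f t) (g t) => [? ?] [].
rewrite (_ : (fun _ => _) = (fun t => complex.Im (f t) + complex.Im (g t))).
  exact: measurable_funD.
by apply/funext => t; case: (f t) (g t) => [? ?] [].
Qed.

Lemma complex_rvM (f g : T -> R[i]) :
  complex_rv f -> complex_rv g -> complex_rv (fun t => f t * g t).
Proof.
move=> /complex_rvP[fr fi] /complex_rvP[gr gi]; apply/complex_rvP.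
split.
  rewrite (_ : (fun _ => _) = (fun t => complex.Re (f t) * complex.Re (g t)
                                      - complex.Im (f t) * complex.Im (g t))).
    by apply: measurable_funB; exact: measurable_funM.
  by apply/funext => t; case: (f t) (g t) => [? ?] [].
rewrite (_ : (fun _ => _) = (fun t => complex.Re (f t) * complex.Im (g t)
                                    + complex.Im (f t) * complex.Re (g t))).
  by apply: measurable_funD; exact: measurable_funM.
by apply/funext => t; case: (f t) (g t) => [? ?] [].
Qed.

Lemma complex_rv_conj (f : T -> R[i]) :
  complex_rv f -> complex_rv (fun t => Num.conj (f t)).
Proof.
move=> /complex_rvP[fr fi]; apply/complex_rvP; split.
  rewrite (_ : (fun _ => _) = (fun t => complex.Re (f t)))//.
  by apply/funext => t; case: (f t).
rewrite (_ : (fun _ => _) = (fun t => - complex.Im (f t))).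
  exact: measurable_funN.
by apply/funext => t; case: (f t).
Qed.

Lemma complex_rv_sum (J : Type) (r : seq J) (f : J -> T -> R[i]) :
  (forall j, complex_rv (f j)) -> complex_rv (fun t => \sum_(j <- r) f j t).
Proof.
move=> mf; elim: r => [|j r IH].
  rewrite (_ : (fun _ => _) = (fun=> 0)); first exact: complex_rv_cst.
  by apply/funext => t; rewrite big_nil.
rewrite (_ : (fun _ => _) = (fun t => f j t + \sum_(j <- r) f j t)).
  exact: complex_rvD.
by apply/funext => t; rewrite big_cons.
Qed.

Lemma measurable_cmodulus_sqr (f : T -> R[i]) :
  complex_rv f -> measurable_fun setT (fun t => cmodulus (f t) ^+ 2).
Proof.
move=> /complex_rvP[fr fi].
rewrite (_ : (fun _ => _) =
  (fun t => complex.Re (f t) ^+ 2 + complex.Im (f t) ^+ 2)).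
  by apply: measurable_funD; exact: measurable_funX.
apply/funext => t; case: (f t) => a b /=.
by rewrite /cmodulus /= sqr_sqrtr// addr_ge0// sqr_ge0.
Qed.

Lemma complex_rv_mulmx (m n p : nat) (A : T -> 'M[R[i]]_(m, n))
    (B : T -> 'M[R[i]]_(n, p)) :
  (forall i j, complex_rv (fun t => A t i j)) ->
  (forall i j, complex_rv (fun t => B t i j)) ->
  forall i j, complex_rv (fun t => (A t *m B t) i j).
Proof.
move=> mA mB i j.
rewrite (_ : (fun _ => _) = (fun t => \sum_k A t i k * B t k j)).
  by apply: complex_rv_sum => k; exact: complex_rvM.
by apply/funext => t; rewrite mxE.
Qed.

(** The ambiguity function is a product of matrices with constant entries or entries built from [s],
    hence a polynomial in the symbols and their conjugates. *)
Lemma measurable_sq_dpaf (N : nat) (s : T -> 'cV[R[i]]_N) (k q : 'I_N) :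
  (forall i, complex_rv (fun t => s t i 0)) ->
  measurable_fun setT (fun t => cmodulus (dpaf (ofdm_signal (s t)) k q) ^+ 2).
Proof.
move=> ms; apply: measurable_cmodulus_sqr.
have mc m n (M : 'M[R[i]]_(m, n)) i j : complex_rv (fun _ : T => M i j).
  exact: complex_rv_cst.
have mx (i : 'I_N) (j : 'I_1) : complex_rv (fun t => ofdm_signal (s t) i j).
  by apply: complex_rv_mulmx => // {}i {}j; rewrite ord1.
apply: complex_rv_mulmx => //; apply: complex_rv_mulmx => //.
apply: complex_rv_mulmx => // i j.
rewrite (_ : (fun _ => _) = (fun t => Num.conj (ofdm_signal (s t) j i))).
  exact: complex_rv_conj.
by apply/funext => t; rewrite !mxE.
Qed.

End Cmeasurable.

(** * The law of a symbol vector: uniqueness and behaviour under shifts *)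

Section Law.
Local Open Scope classical_set_scope.
Context {R : realType} {N : nat} {dD : measure_display}
  {TD : measurableType dD} (PD : probability TD R) (D : TD -> R[i]).

(** Together with [coords] this moves complex vectors to and from tuples of real pairs, whose
    product sigma-algebra carries the law of a symbol vector. *)
Definition ofRR (v : N.-tuple (R * R)) : 'cV[R[i]]_N :=
  \col_i ((tnth v i).1 +i* (tnth v i).2).

Definition coords (s : 'cV[R[i]]_N) : N.-tuple (R * R) :=
  [tuple toRR (s i 0) | i < N].

Lemma complex_rv_ofRR (i : 'I_N) :
  complex_rv (fun v : N.-tuple (R * R) => ofRR v i 0).
Proof.
rewrite /complex_rv (_ : _ \o _ = @tnth _ _ ^~ i); first exact: measurable_tnth.
by apply/funext => v /=; rewrite mxE; case: (tnth v i).
Qed.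

Lemma coordsK : cancel coords ofRR.
Proof.
by move=> s; apply/colP => i; rewrite mxE tnth_mktuple /=; case: (s i 0).
Qed.

Section OneModel.
Context (p w : 'cV[R[i]]_N) (hw : forall i, w i 0 = 1 \/ w i 0 = 0)
  (d : measure_display) (T : measurableType d) (P : probability T R)
  (s : T -> 'cV[R[i]]_N) (hs : ofdm_symbols PD D p w P s).

Lemma ofdm_symbols_rv i : complex_rv (fun t => s t i 0).
Proof.
have [w1|w0] := hw i; last exact: (ofdm_data_rv hs w0).
rewrite (_ : (fun _ => _) = (fun=> p i 0)); first exact: complex_rv_cst.
by apply/funext => t; exact: (ofdm_pilot hs w1).
Qed.

Lemma measurable_coords : measurable_fun setT (coords \o s).
Proof.
apply/measurable_fun_tnthP => i.
rewrite (_ : _ \o _ = toRR \o (fun t => s t i 0)).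
  exact: ofdm_symbols_rv.
by apply/funext => t /=; rewrite tnth_mktuple.
Qed.

Lemma ofdm_symbols_box (B : 'I_N -> set (R * R)) :
  (forall i, measurable (B i)) ->
  P ((coords \o s) @^-1` box B) =
  (if `[< forall i, w i 0%R = 1%R -> B i (toRR (p i 0%R)) >]
   then \prod_(i | w i (0 : 'I_1)%R == (0 : R[i])%R) PD ((toRR \o D) @^-1` B i) else 0)%E.
Proof.
move=> mB; case: asboolP => [hB|].
  rewrite (_ : _ @^-1` _ = \bigcap_(i in [set i | i \in [set i | w i 0 == 0]%SET])
      ((toRR \o (fun t => s t i 0)) @^-1` B i)).
    rewrite (ofdm_data_indep hs)//.
    rewrite (eq_bigl (fun i => w i 0 == 0)); last by move=> i; rewrite inE.
    by apply: eq_bigr => i /eqP w0; exact: (ofdm_data_law hs w0).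
  apply/seteqP; split=> [t Bt i _|t Bt i] /=.
    by have := Bt i; rewrite tnth_mktuple.
  rewrite tnth_mktuple; have [w1|w0] := hw i.
    by rewrite (ofdm_pilot hs w1); exact: hB.
  by apply: Bt; rewrite /= inE w0.
(* A pilot outside its side of the box makes the event empty. *)
move=> nB; rewrite (_ : _ @^-1` _ = set0) ?measure0//.
apply/seteqP; split=> // t Bt; apply: nB => i w1.
by rewrite -(ofdm_pilot hs w1 t); have := Bt i; rewrite tnth_mktuple.
Qed.

End OneModel.

(** By the box formula both vectors push their probabilities forward to the same law on tuples, even
    from different sample spaces. Nonnegativity of [f] permits the change of variables without
    integrability. *)
Lemma ofdm_symbols_expectation (p w : 'cV[R[i]]_N)
    (hw : forall i, w i 0 = 1 \/ w i 0 = 0)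
    (d1 : measure_display) (T1 : measurableType d1) (P1 : probability T1 R)
    (s1 : T1 -> 'cV[R[i]]_N) (hs1 : ofdm_symbols PD D p w P1 s1)
    (d2 : measure_display) (T2 : measurableType d2) (P2 : probability T2 R)
    (s2 : T2 -> 'cV[R[i]]_N) (hs2 : ofdm_symbols PD D p w P2 s2)
    (f : 'cV[R[i]]_N -> R) :
  (forall x, 0 <= f x) -> measurable_fun setT (f \o ofRR) ->
  ('E_P1[f \o s1] = 'E_P2[f \o s2])%E.
Proof.
move=> f0 mf.
pose X1 : {mfun T1 >-> N.-tuple (R * R)} := HB.pack (coords \o s1)
  (isMeasurableFun.Build _ _ _ _ _ (measurable_coords hw hs1)).
pose X2 : {mfun T2 >-> N.-tuple (R * R)} := HB.pack (coords \o s2)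
  (isMeasurableFun.Build _ _ _ _ _ (measurable_coords hw hs2)).
(* Change of variables to the law of the coordinates; [coordsK] recovers [s] from them. *)
have push d (T : measurableType d) (P : probability T R) s
    (X : {mfun T >-> N.-tuple (R * R)}) : X = coords \o s :> (T -> _) ->
    ('E_P[f \o s] = \int[distribution P X]_v ((f \o ofRR) v)%:E)%E.
  move=> Xs; rewrite ge0_integral_pushforward//.
  - rewrite unlock preimage_setT; apply: eq_integral => t _ /=.
    by rewrite Xs /= coordsK.
  - exact/measurable_EFinP.
  - by move=> v _; rewrite lee_fin /=.
rewrite (push _ _ _ s1 X1)// (push _ _ _ s2 X2)//.
apply: eq_measure_integral => A mA _.
apply: (eq_measure_box _ _ mA) => [|B mB].
  by apply: (@le_lt_trans _ _ 1%E); [exact: probability_le1|exact: ltry].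
exact: etrans (ofdm_symbols_box hw hs1 mB) (esym (ofdm_symbols_box hw hs2 mB)).
Qed.

(** A shift merely relabels the entries by a permutation, and every condition of the model is
    transported along it; only independence requires reindexing. *)
Lemma ofdm_symbols_shift (p w : 'cV[R[i]]_N) (d : measure_display)
    (T : measurableType d) (P : probability T R) (s : T -> 'cV[R[i]]_N)
    (c : int) :
  ofdm_symbols PD D p w P s ->
  ofdm_symbols PD D (cyclic_shift c p) (cyclic_shift c w) P
    (fun t => cyclic_shift c (s t)).
Proof.
move=> hs.
have sE i : (fun t => cyclic_shift c (s t) i 0) = (fun t => s t (mod_sub c i) 0).
  by apply/funext => t; rewrite mxE.
split.
- by move=> i; rewrite !mxE => wi t; rewrite mxE; exact: (ofdm_pilot hs wi).
- by move=> i; rewrite mxE sE; exact: (ofdm_data_rv hs).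
- by move=> i; rewrite mxE sE; exact: (ofdm_data_law hs).
move=> J B /fintype.subsetP Jw mB.
have inj := can_inj (@mod_subK N c).
(* Entry [i] of the shifted vector is entry [mod_sub c i] of [s], so the event sets are relabelled
   by the inverse shift and [J] by its image. *)
pose B' i := B (mod_sub (- c) i).
have -> : \bigcap_(i in [set i | i \in J])
    ((toRR \o (fun t => cyclic_shift c (s t) i 0)) @^-1` B i) =
  \bigcap_(i in [set i | i \in (@mod_sub N c @: J)%SET])
    ((toRR \o (fun t => s t i 0)) @^-1` B' i).
  apply/seteqP; split=> t Bt i /=.
    by move=> /imsetP[j jJ ->]; rewrite /B' mod_subK; have := Bt j jJ; rewrite /= mxE.
  move=> iJ; rewrite mxE; have := Bt (mod_sub c i) (imset_f _ iJ).
  by rewrite /= /B' mod_subK.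
rewrite (ofdm_data_indep hs).
- rewrite big_imset/=; last by move=> i j _ _; exact: inj.
  by apply: eq_bigr => i _; rewrite /B' mod_subK sE.
- by apply/fintype.subsetP => _ /imsetP[i /Jw + ->]; rewrite !inE mxE.
- by move=> i; exact: mB.
Qed.

End Law.

Theorem corollary2 (R : realType) (N L : nat) (hN : (1 <= N)%N) (hL : (L <= N)%N)
    (dD : measure_display) (TD : measurableType dD) (PD : probability TD R)
    (D : TD -> R[i]) (hD : data_symbol_law PD D)
    (I : {set 'I_N}) (hI : #|I| = L)
    (p w : 'cV[R[i]]_N) (hp : unit_pilot_vector I p) (hw : w = pilot_mask I)
    (c : int)
    (p' w' : 'cV[R[i]]_N)
    (hp' : p' = cyclic_shift c p) (hw' : w' = cyclic_shift c w)
    (d1 : measure_display) (T1 : measurableType d1) (P1 : probability T1 R)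
    (s : T1 -> 'cV[R[i]]_N) (hs : ofdm_symbols PD D p w P1 s)
    (d2 : measure_display) (T2 : measurableType d2) (P2 : probability T2 R)
    (s' : T2 -> 'cV[R[i]]_N) (hs' : ofdm_symbols PD D p' w' P2 s') :
  forall k q : 'I_N, expected_sq_dpaf P2 s' k q = expected_sq_dpaf P1 s k q.
Proof.
move=> k q.
have w01 i : w i 0 = 1 \/ w i 0 = 0.
  by rewrite hw mxE; case: (i \in I); [left|right].
have w'01 i : w' i 0 = 1 \/ w' i 0 = 0 by rewrite hw' mxE.
(* The shifted [s], living on [T1], is a second model with the pilots and mask of [s']; it links the
   two sample spaces. *)
have hcs := ofdm_symbols_shift c hs; rewrite -hp' -hw' in hcs.
pose f (x : 'cV[R[i]]_N) : R := cmodulus (dpaf (ofdm_signal x) k q) ^+ 2.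
have f0 x : 0 <= f x by exact: sqr_ge0.
have mf : measurable_fun setT (f \o @ofRR R N).
  by apply: measurable_sq_dpaf => i; exact: complex_rv_ofRR.
(* Equality in law replaces [s'] by the shifted [s]; the remaining equality of integrands holds at
   every sample point. *)
rewrite /expected_sq_dpaf (ofdm_symbols_expectation w'01 hs' hcs f0 mf).
by congr ('E_P1[_])%E; apply/funext => t; rewrite /f /= cmodulus_dpaf_shift.
Qed.
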